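(* Let $\ast$ be a binary operation on $I=[0,1]$ and let $\Delta$ be a t-norm on $I$. If the binary operation $\widetilde{\Delta}_{\ast}$ is a t$_{r}$-norm on $\mathbf{L}$, then $\Delta$ is a continuous t-norm on $I$ and $\ast$ is a t-norm on $I$.
   Context: Let $I=[0,1]$ and let $\mathbf{M}$ be the set of all maps $I\to I$; $\wedge,\vee$ denote minimum and maximum of real numbers. A function $f\in\mathbf{M}$ is normal if $\sup\{f(x)\mid x\in I\}=1$, and convex if $f(y)\ge f(x)\wedge f(z)$ whenever $0\le x\le y\le z\le 1$. $\mathbf{L}$ is the set of all normal and convex $f\in\mathbf{M}$. For $B\subseteq I$, $\bm{1}_B\in\mathbf{M}$ is the characteristic function of $B$. Let $\mathbf{J}=\{\bm{1}_{\{x\}}\mid x\in I\}$ and $\mathbf{K}=\{\bm{1}_{[a,b]}\mid 0\le a\le b\le 1\}$. For $f,g\in\mathbf{M}$ define $(f\sqcap g)(x)=\sup\{f(y)\wedge g(z)\mid y\wedge z=x\}$, and write $f\sqsubseteq g$ if $f\sqcap g=f$. A t-norm on $I$ is a binary operation $I^2\to I$ that is commutative, associative, increasing (non-decreasing) in each argument, and has neutral element $1$. Given a binary operation $\ast:I^2\to I$ (arbitrary) and a t-norm $\Delta$ on $I$, the binary operation $\widetilde{\Delta}_{\ast}:\mathbf{M}^2\to\mathbf{M}$ is defined by $$(f\,\widetilde{\Delta}_{\ast}\,g)(x)=\sup\{f(y)\ast g(z)\mid y,z\in I,\ y\Delta z=x\},\qquad f,g\in\mathbf{M},\ x\in I.$$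 A t$_{r}$-norm on $\mathbf{L}$ is a binary operation $T:\mathbf{L}^2\to\mathbf{L}$ such that: (O1) $T(f,g)=T(g,f)$ for all $f,g\in\mathbf{L}$; (O2) $T(T(f,g),h)=T(f,T(g,h))$ for all $f,g,h\in\mathbf{L}$; (O3) $T(f,\bm{1}_{\{1\}})=f$ for all $f\in\mathbf{L}$; (O4) for $f,g,h\in\mathbf{L}$ with $f\sqsubseteq g$, $T(f,h)\sqsubseteq T(g,h)$; (O5) $T(\bm{1}_{[0,1]},\bm{1}_{[a,b]})=\bm{1}_{[0,b]}$ for all $0\le a\le b\le 1$; (O6) $T$ is closed on $\mathbf{J}$; (O7) $T$ is closed on $\mathbf{K}$. Saying that $\widetilde{\Delta}_{\ast}$ is a t$_{r}$-norm on $\mathbf{L}$ means that its restriction to $\mathbf{L}^2$ takes values in $\mathbf{L}$ and is a t$_r$-norm. *)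

(* Defs.v *)
(* The unit interval is represented by the type {i01 R}. *)
From HB Require Import structures.
From mathcomp Require Import all_boot all_order all_algebra.
From mathcomp Require Import all_classical all_reals all_analysis.

Set Implicit Arguments.
Unset Strict Implicit.
Unset Printing Implicit Defensive.

Import Order.TTheory GRing.Theory Num.Theory.
Import numFieldNormedType.Exports.

Local Open Scope classical_set_scope.
Local Open Scope ring_scope.

(* {i01 R} comes with its order but without a topology: give it the one
   induced by R. *)
HB.instance Definition _ (R : realType) :=
  Topological.copy {i01 R}
    (initial_topology (fun x : {i01 R} => x%:num : R)).

Section sup01.
Variables (R : realType) (A : set {i01 R}).

Let S : set R := [set x%:num | x in A].

Lemma sup01_ge0 : 0 <= sup S.
Proof.
have [->|/set0P[y Sy]] := eqVneq S set0; first by rewrite sup0.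
apply: (@le_trans _ _ y); first by case: Sy => x _ <-.
by apply: ub_le_sup => //; exists 1 => _ [x _ <-].
Qed.

Lemma sup01_le1 : sup S <= 1.
Proof.
have [->|S0] := eqVneq S set0; first by rewrite sup0.
by apply: ge_sup; [exact/set0P | move=> _ [x _ <-]].
Qed.

(* As in R, the supremum of the empty set is 0. *)
Definition sup01 : {i01 R} := Itv01 sup01_ge0 sup01_le1.

End sup01.

Section truth_values.
Variable R : realType.
Local Notation I := {i01 R}.
Local Notation M := (I -> I).

Definition is_normal (f : M) : Prop := sup01 (range f) = 1%:i01.

Definition is_convex (f : M) : Prop :=
  forall x y z : I, x <= y -> y <= z -> Order.min (f x) (f z) <= f y.

Definition setL : set M := [set f | is_normal f /\ is_convex f].

Definition chi (B : set I) : M := fun x => if x \in B then 1%:i01 else 0%:i01.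

Definition setJ : set M := [set chi [set x] | x in [set: I]].

Definition setK : set M :=
  [set f | exists a b : I, a <= b /\ f = chi `[a, b]%classic].

(* f g |-> (x |-> sup {f(y) * g(z) | y D z = x}) *)
Definition convolution (star D : I -> I -> I) (f g : M) : M :=
  fun x => sup01 [set w | exists y z : I, D y z = x /\ w = star (f y) (g z)].

Definition sqcap : M -> M -> M := convolution Order.min Order.min.

Definition sqsubseteq (f g : M) : Prop := sqcap f g = f.

Record is_tnorm (D : I -> I -> I) : Prop := IsTnorm {
  tnormC : commutative D ;
  tnormA : associative D ;
  tnorm_lel : forall x y z : I, x <= y -> D x z <= D y z ;
  tnorm_ler : forall x y z : I, x <= y -> D z x <= D z y ;
  tnorm_1r : forall x : I, D x 1%:i01 = x ;
  tnorm_1l : forall x : I, D 1%:i01 x = x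
}.

Definition is_continuous_tnorm (D : I -> I -> I) : Prop :=
  is_tnorm D /\ continuous (fun p : I * I => D p.1 p.2).

(* The restriction of T to setL takes values in setL and is a t_r-norm. *)
Record is_trnorm (T : M -> M -> M) : Prop := IsTrnorm {
  trnorm_closed : forall f g, setL f -> setL g -> setL (T f g) ;
  trnorm_O1 : forall f g, setL f -> setL g -> T f g = T g f ;
  trnorm_O2 : forall f g h, setL f -> setL g -> setL h ->
    T (T f g) h = T f (T g h) ;
  trnorm_O3 : forall f, setL f -> T f (chi [set 1%:i01]) = f ;
  trnorm_O4 : forall f g h, setL f -> setL g -> setL h ->
    sqsubseteq f g -> sqsubseteq (T f h) (T g h) ;
  trnorm_O5 : forall a b : I, a <= b ->
    T (chi `[0%:i01, 1%:i01]%classic) (chi `[a, b]%classic)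
    = chi `[0%:i01, b]%classic ;
  trnorm_O6 : forall f g, setJ f -> setJ g -> setJ (T f g) ;
  trnorm_O7 : forall f g, setK f -> setK g -> setK (T f g)
}.

End truth_values.

(* Main.v *)
Require Import Defs.
From mathcomp Require Import all_boot all_order all_algebra.
From mathcomp Require Import all_classical all_reals all_analysis.

(** The proof evaluates convolutions at two kinds of arguments.

    For a t-norm [Delta], [Delta y z = 1] forces [y = z = 1], so at the point
    1 the convolution has a single contribution: its value there is
    [star (f 1) (g 1)] ([convolution_at1]).  The functions [drop_at1 a], equal
    to 1 everywhere except for the value [a] at 1, are normal and convex, and
    are ordered by [sqsubseteq] as their parameters are.  Hence each of
    [trnorm_O1] to [trnorm_O4], read off at 1 for such functions (together with
    the characteristic function of [{1}] in [trnorm_O3]), is a t-norm axiom for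
    [star] ([trnorm_star_tnorm]).

    In particular [star] acts on 0 and 1 as conjunction.  Therefore, in
    [trnorm_O5] with [a = b], the supremum at a point [x <= b] on the left-hand
    side can only equal 1 if some [y] satisfies [Delta y b = x].  So every section
    [Delta ^~ b] maps onto [[0, b]] ([trnorm_section_onto]).  A nondecreasing
    map with no gap in its range has no jump, and separate continuity of a map
    that is monotone in each argument yields joint continuity
    ([onto_tnorm_continuous]). *)

Set Implicit Arguments.
Unset Strict Implicit.
Unset Printing Implicit Defensive.

Import Order.TTheory GRing.Theory Num.Theory.
Import numFieldNormedType.Exports.

Local Open Scope classical_set_scope.
Local Open Scope ring_scope.

(** * The unit interval: order, suprema and continuity *)

Section unit_interval.
Variable R : realType.
Local Notation I := {i01 R}.
Implicit Types (x y : I) (A : set I).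

Lemma i01_ge0 x : 0%:i01 <= x.
Proof. by rewrite -num_le /=. Qed.

Lemma i01_le1 x : x <= 1%:i01.
Proof. by rewrite -num_le /=. Qed.

Lemma i01_ge1_eq x : 1%:i01 <= x -> x = 1%:i01.
Proof. by move=> x1; apply/le_anti; rewrite i01_le1. Qed.

Lemma i01_0_neq1 : (0%:i01 : I) <> 1%:i01.
Proof.
by move/(congr1 (fun x : I => x%:num)) => /= /eqP; rewrite eq_sym oner_eq0.
Qed.

Lemma le_sup01 A x : A x -> x <= sup01 A.
Proof.
move=> Ax; rewrite -num_le /=; apply: ub_le_sup; last by exists x.
by exists 1 => _ [y _ <-].
Qed.

Lemma sup01_le A x : (forall y, A y -> y <= x) -> sup01 A <= x.
Proof.
move=> Ax; rewrite -num_le /=.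
have [->|/set0P S0] := eqVneq [set y%:num | y in A] set0; first by rewrite sup0.
by apply: ge_sup => // _ [y /Ax yx <-]; rewrite num_le.
Qed.

Lemma sup01_set1 x : sup01 [set x] = x.
Proof. by apply/le_anti; rewrite le_sup01 // sup01_le // => y ->. Qed.

Lemma i01_dense x y : x < y -> exists m : I, x < m /\ m < y.
Proof.
rewrite -num_lt => xy.
have [m0 m1] : 0 <= (x%:num + y%:num) / 2 /\ (x%:num + y%:num) / 2 <= 1 :> R.
  split; first by rewrite divr_ge0 // addr_ge0.
  by apply: (le_trans (ltW (midf_lt xy).2)).
by exists (Itv01 m0 m1); rewrite -!num_lt /=; rewrite !midf_lt.
Qed.

Lemma i01_num_continuous : continuous (fun x : I => x%:num : R).
Proof. exact: initial_continuous. Qed.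

Lemma near_i01_le x y : x < y -> \forall z \near x, z <= y.
Proof.
rewrite -num_lt => xy; have := i01_num_continuous (lt_le_nbhsl xy).
rewrite nbhs_simpl /=.
by apply: filterS => z /=; rewrite num_le.
Qed.

Lemma near_i01_ge x y : y < x -> \forall z \near x, y <= z.
Proof.
rewrite -num_lt => xy; have := i01_num_continuous (lt_le_nbhsr xy).
rewrite nbhs_simpl /=.
by apply: filterS => z /=; rewrite num_le.
Qed.

(** The topology of [{i01 R}] is the one induced by [R]; this reduces
    continuity to comparisons within [{i01 R}].  A bound [f p + e] or [f p - e]
    that falls outside [[0, 1]] holds everywhere. *)
Lemma continuous_i01 (T : topologicalType) (f : T -> I) :
  (forall p u, f p < u -> \forall q \near p, f q < u) ->
  (forall p l, l < f p -> \forall q \near p, l < f q) ->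
  continuous f.
Proof.
move=> up lo; apply: continuous_comp_initial => p.
apply/cvgrPdist_lt => /= e e0.
have near_up : \forall q \near p, (f q)%:num < (f p)%:num + e.
  have [fe1|fe1] := leP ((f p)%:num + e) 1.
    have fe0 : 0 <= (f p)%:num + e by rewrite addr_ge0 // ltW.
    have /up : f p < Itv01 fe0 fe1 by rewrite -num_lt /= ltrDl.
    by apply: filterS => q; rewrite -num_lt.
  by apply: nearW => q; exact: le_lt_trans fe1.
have near_lo : \forall q \near p, (f p)%:num - e < (f q)%:num.
  have [fe0|fe0] := leP 0 ((f p)%:num - e).
    have fe1 : (f p)%:num - e <= 1.
      by rewrite lerBlDr (le_trans (_ : (f p)%:num <= 1)) // lerDl ltW.
    have /lo : Itv01 fe0 fe1 < f p by rewrite -num_lt /= ltrBlDr ltrDl.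
    by apply: filterS => q; rewrite -num_lt.
  by apply: nearW => q; exact: lt_le_trans fe0 _.
by apply: filterS2 near_up near_lo => q; rewrite ltr_distlC => -> ->.
Qed.

Lemma chi_in (B : set I) x : B x -> chi B x = 1%:i01.
Proof. by move=> Bx; rewrite /chi mem_set. Qed.

Lemma chi_notin (B : set I) x : ~ B x -> chi B x = 0%:i01.
Proof. by move=> Bx; rewrite /chi memNset. Qed.

End unit_interval.

(** * Continuity of t-norms whose sections have full range *)

Section tnorm.
Variable R : realType.
Local Notation I := {i01 R}.
Variable D : I -> I -> I.
Hypothesis tD : is_tnorm D.

Lemma tnorm_ge_right y z : D y z <= z.
Proof. by rewrite -{2}[z](tnorm_1l tD); apply: tnorm_lel; rewrite ?i01_le1. Qed.

Lemma tnorm_eq1 y z : D y z = 1%:i01 -> y = 1%:i01 /\ z = 1%:i01.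
Proof.
move=> D1; split; apply: i01_ge1_eq; rewrite -D1.
  by rewrite (tnormC tD) tnorm_ge_right.
exact: tnorm_ge_right.
Qed.

(** As 1 has a single decomposition under a t-norm, the supremum defining a
    convolution reduces to one term there. *)
Lemma convolution_at1 star f g :
  convolution star D f g 1%:i01 = star (f 1%:i01) (g 1%:i01).
Proof.
rewrite /convolution -[RHS]sup01_set1; congr sup01.
apply/seteqP; split => w /= [].
  by move=> y [z [/tnorm_eq1[-> ->]]].
by exists 1%:i01, 1%:i01; rewrite (tnorm_1l tD).
Qed.

Section onto_continuous.
Hypothesis onto : forall b x, x <= b -> exists y, D y b = x.

(** If [u <= b], the map [D ^~ b] takes some value strictly between [D a b]
    and [u], at a point [a'] which lies above [a] by monotonicity.  If [u > b],
    then [D a b] may be the maximum [b] of that map, and [a' = 1] serves. *)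
Lemma tnorm_below_near a b u : D a b < u ->
  exists a', D a' b < u /\ \forall y \near a, y <= a'.
Proof.
move=> Dab; have [bu|ub] := ltP b u.
  exists 1%:i01; rewrite (tnorm_1l tD); split => //.
  by apply: (@nearW _ (nbhs a)) => y; exact: i01_le1.
have [m [Dm mu]] := i01_dense Dab.
have [a' Da'] := onto (ltW (lt_le_trans mu ub)).
exists a'; rewrite Da'; split=> //; apply: near_i01_le.
rewrite ltNge; apply/negP => /(tnorm_lel tD b).
by rewrite Da' leNgt Dm.
Qed.

(** Here no case distinction arises: a value strictly below [D a b] is below
    [b], hence in the range of [D ^~ b]. *)
Lemma tnorm_above_near a b l : l < D a b ->
  exists a', l < D a' b /\ \forall y \near a, a' <= y.
Proof.
move=> Dab; have [m [lm mD]] := i01_dense Dab.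
have [a' Da'] := onto (ltW (lt_le_trans mD (tnorm_ge_right a b))).
exists a'; rewrite Da'; split=> //; apply: near_i01_ge.
rewrite ltNge; apply/negP => /(tnorm_lel tD b).
by rewrite Da' leNgt mD.
Qed.

(** Moving first one argument and then the other yields a corner [(a', b')]
    whose value still satisfies the bound and which lies, componentwise, on
    one side of a whole neighbourhood of [(a, b)]. *)
Lemma onto_tnorm_continuous : continuous (fun p : I * I => D p.1 p.2).
Proof.
apply: continuous_i01 => -[a b] /= c.
- move=> /tnorm_below_near[a' [Da'b na]].
  move: Da'b; rewrite (tnormC tD) => /tnorm_below_near[b' [Db'a' nb]].
  exists ([set y | y <= a'], [set z | z <= b']) => //= -[y z] /= [ya' zb'].
  apply: le_lt_trans Db'a'; rewrite (tnormC tD b').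
  exact: le_trans (tnorm_lel tD z ya') (tnorm_ler tD a' zb').
- move=> /tnorm_above_near[a' [Da'b na]].
  move: Da'b; rewrite (tnormC tD) => /tnorm_above_near[b' [Db'a' nb]].
  exists ([set y | a' <= y], [set z | b' <= z]) => //= -[y z] /= [ya' zb'].
  apply: (lt_le_trans Db'a'); rewrite (tnormC tD b').
  exact: le_trans (tnorm_lel tD b' ya') (tnorm_ler tD y zb').
Qed.

End onto_continuous.
End tnorm.

(** * Normal convex functions with a prescribed value at 1 *)

(** This makes [convolution_at1] apply to [sqcap], hence to the order. *)
Lemma min_tnorm (R : realType) : is_tnorm (@Order.min _ {i01 R}).
Proof.
split.
- exact: minC.
- exact: minA.
- by move=> x y z xy; rewrite le_min !ge_min xy lexx orbT.
- by move=> x y z xy; rewrite le_min !ge_min xy lexx orbT.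
- by move=> x; apply/min_idPl; exact: i01_le1.
- by move=> x; apply/min_idPr; exact: i01_le1.
Qed.

Section drop_at1.
Variable R : realType.
Local Notation I := {i01 R}.

(** These functions are elements of [setL] which take an arbitrary value at 1:
    being normal through their values elsewhere, they leave [a] free. *)
Definition drop_at1 (a : I) : I -> I :=
  fun x => if x == 1%:i01 then a else 1%:i01.

Lemma drop_at1_1 a : drop_at1 a 1%:i01 = a.
Proof. by rewrite /drop_at1 eqxx. Qed.

Lemma drop_at1_neq1 a x : x != 1%:i01 -> drop_at1 a x = 1%:i01.
Proof. by rewrite /drop_at1 => /negbTE ->. Qed.

Lemma drop_at1_setL a : setL (drop_at1 a).
Proof.
split.
  apply: i01_ge1_eq; apply: le_sup01; exists 0%:i01 => //.
  by apply: drop_at1_neq1; apply/eqP; exact: i01_0_neq1.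
move=> x y z _; rewrite /drop_at1; have [->|_ _] := eqVneq y; last exact: i01_le1.
by move=> /i01_ge1_eq ->; rewrite eqxx ge_min lexx orbT.
Qed.

Lemma drop_at1_sqsubseteq a b :
  a <= b -> sqsubseteq (drop_at1 a) (drop_at1 b).
Proof.
move=> ab; apply/funext => x; have [->|x1] := eqVneq x 1%:i01.
  rewrite /sqcap (convolution_at1 (@min_tnorm R)) !drop_at1_1.
  exact/min_idPl.
rewrite (drop_at1_neq1 a x1); apply: i01_ge1_eq; apply: le_sup01.
by exists x, x; rewrite !drop_at1_neq1 // !minxx.
Qed.

End drop_at1.

(** * Consequences of the axioms for the convolution *)

Section trnorm_convolution.
Variable R : realType.
Local Notation I := {i01 R}.
Variables star D : I -> I -> I.
Hypothesis tD : is_tnorm D.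
Hypothesis trT : is_trnorm (convolution star D).
Local Notation T := (convolution star D).

Lemma convolution_drop_at1 a b :
  T (drop_at1 a) (drop_at1 b) 1%:i01 = star a b.
Proof. by rewrite convolution_at1 // !drop_at1_1. Qed.

Lemma trnorm_star_tnorm : is_tnorm star.
Proof.
have L := @drop_at1_setL R.
have starC : commutative star.
  by move=> a b; rewrite -!convolution_drop_at1 (trnorm_O1 trT (L a) (L b)).
have star1 a : star a 1%:i01 = a.
  rewrite -[RHS]drop_at1_1 -(trnorm_O3 trT (L a)) convolution_at1 //.
  by rewrite drop_at1_1 chi_in.
have star_le a b c : a <= b -> star a c <= star b c.
  move=> /drop_at1_sqsubseteq/(trnorm_O4 trT (L a) (L b) (L c)).
  move=> /funeqP/(_ 1%:i01).
  rewrite /sqcap (convolution_at1 (@min_tnorm R)) !convolution_drop_at1.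
  by move/min_idPl.
split=> //.
- move=> a b c.
  have /funeqP/(_ 1%:i01) := trnorm_O2 trT (L a) (L b) (L c).
  by rewrite !(convolution_at1 tD) !drop_at1_1.
- by move=> a b c ab; rewrite ![star c _]starC star_le.
- by move=> a; rewrite starC star1.
Qed.

(** If [x] were not of the form [D y b], every decomposition [D y z = x] would
    have [z <> b] and contribute [star 1 0 = 0] to the convolution of the
    characteristic functions of [[0, 1]] and [[b, b]], whose value at [x] is 1
    by [trnorm_O5]. *)
Lemma trnorm_section_onto b x : x <= b -> exists y, D y b = x.
Proof.
move=> xb; apply: contrapT => notonto.
have /funeqP/(_ x) := trnorm_O5 trT (lexx b).
rewrite (@chi_in _ `[0%:i01, b]%classic x) /= ?in_itv /= ?i01_ge0 // => T1.
apply: (@i01_0_neq1 R); rewrite -T1; apply/le_anti; rewrite i01_ge0 /=.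
apply: sup01_le => w [y [z [Dyz ->]]].
rewrite chi_in /= ?in_itv /= ?i01_ge0 ?i01_le1 // (tnorm_1l trnorm_star_tnorm).
rewrite chi_notin //= in_itv /= => /andP[bz zb].
by apply: notonto; exists y; rewrite -Dyz; congr D; apply/le_anti; rewrite bz.
Qed.

End trnorm_convolution.

Theorem theorem11 (R : realType)
    (star Delta : {i01 R} -> {i01 R} -> {i01 R}) :
  is_tnorm Delta ->
  is_trnorm (convolution star Delta) ->
  is_continuous_tnorm Delta /\ is_tnorm star.
Proof.
move=> tD trT; split; last exact: trnorm_star_tnorm trT.
split=> //; apply: onto_tnorm_continuous => //.
exact: trnorm_section_onto trT.
Qed.
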